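(* For a real number $K\ge 1$, let $t\ge 1$ be the unique integer for which $$\frac{\binom{t}{2}+t+1}{t+1}\ \le\ K\ <\ \frac{\binom{t+1}{2}+(t+1)+1}{(t+1)+1},$$ and define $$F(K)=\begin{cases}\dfrac{2^t}{\binom{t}{2}+t+1}\cdot K & \text{if } \dfrac{\binom{t}{2}+t+1}{t+1}\le K<\dfrac{t^2+t+1}{2t},\\[3mm] \dfrac{2^{t+1}}{t^2+t+1}\cdot K & \text{if } \dfrac{t^2+t+1}{2t}\le K<\dfrac{\binom{t+1}{2}+(t+1)+1}{(t+1)+1}.\end{cases}$$ Then for every $n$ and every nonempty $A\subseteq\mathbb{Z}_2^n$ with $|A+A|/|A|\le K$ we have $|\langle A\rangle|/|A|\le F(K)$. This choice of $F(K)$ is tight, i.e. for every $K\ge1$ $$F(K)=\sup\left\{\frac{|\langle A\rangle|}{|A|} : n\in\mathbb{N},\ \varnothing\ne A\subseteq\mathbb{Z}_2^n,\ \frac{|A+A|}{|A|}\le K\right\},$$ and $F(K)$ grows as $\Theta(2^{2K}/K)$ as $K\to\infty$.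
   Context: $A+A=\{a+a' : a,a'\in A\}$. The affine span $\langle A\rangle$ is the smallest coset (of any subgroup of $\mathbb{Z}_2^n$) containing $A$. The two conditions in the case distinction are to be read for $K$ in the half-open interval determining $t$ (for $t=1$ and $t=2$ only the first case occurs). *)

(* Defs.v *)
From HB Require Import structures.
From mathcomp Require Import all_boot all_order all_algebra all_fingroup.
From mathcomp Require Import all_classical all_reals all_analysis.

Set Implicit Arguments.
Unset Strict Implicit.
Unset Printing Implicit Defensive.

Import Order.TTheory GRing.Theory Num.Theory.
Import numFieldNormedType.Exports.

Local Open Scope ring_scope.

Definition sumset (n : nat) (A : {set 'rV['F_2]_n}) : {set 'rV['F_2]_n} :=
  [set (a + b)%R | a in A, b in A].

(* The group law of 'rV['F_2]_n as a finGroupType is matrix addition, so     *)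
(* {group 'rV['F_2]_n} is the type of additive subgroups.                    *)
Definition is_coset (n : nat) (C : {set 'rV['F_2]_n}) : bool :=
  [exists H : {group 'rV['F_2]_n}, C \in rcosets H [set: 'rV['F_2]_n]].

(* The lemmas below show that, for nonempty A, this intersection is itself a *)
(* coset containing A, and hence the smallest one.                           *)
Definition affine_span (n : nat) (A : {set 'rV['F_2]_n}) :
    {set 'rV['F_2]_n} :=
  (\bigcap_(C : {set 'rV['F_2]_n} | is_coset C && (A \subset C)) C)%SET.

Lemma affine_span_sub (n : nat) (A : {set 'rV['F_2]_n}) :
  A \subset affine_span A.
Proof. by apply/finset.bigcapsP => C /andP[]. Qed.

Lemma affine_span_min (n : nat) (A C : {set 'rV['F_2]_n}) :
  is_coset C -> A \subset C -> affine_span A \subset C.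
Proof. by move=> hC hA; apply: finset.bigcap_inf; rewrite hC hA. Qed.

Lemma is_cosetI (n : nat) (B C : {set 'rV['F_2]_n}) (a : 'rV['F_2]_n) :
  a \in B -> a \in C -> is_coset B -> is_coset C -> is_coset (B :&: C).
Proof.
move=> aB aC /existsP[H /rcosetsP[x _ eB]] /existsP[K /rcosetsP[y _ eC]].
apply/existsP; exists (H :&: K)%G; apply/rcosetsP; exists a => //.
have {}eB : B = (H :* a)%g by rewrite eB; apply/esym/rcoset_eqP; rewrite -eB.
have {}eC : C = (K :* a)%g by rewrite eC; apply/esym/rcoset_eqP; rewrite -eC.
by apply/setP => z; rewrite eB eC !inE !mem_rcoset !inE.
Qed.

Lemma affine_span_coset (n : nat) (A : {set 'rV['F_2]_n}) :
  A != finset.set0 -> is_coset (affine_span A).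
Proof.
move=> /set0Pn[a aA].
suff /andP[] : is_coset (affine_span A) && (a \in affine_span A) by [].
rewrite /affine_span; elim/big_ind: _ => [|B C /andP[hB aB] /andP[hC aC]|C].
- rewrite inE andbT; apply/existsP; exists [set: 'rV['F_2]_n]%G.
  by apply/rcosetsP; exists 0 => //; apply/setP => z; rewrite mem_rcoset !inE.
- by rewrite (is_cosetI aB aC hB hC) inE aB aC.
- by move=> /andP[-> /fintype.subsetP/(_ a aA) ->].
Qed.

Section F.
Variable R : realType.
Implicit Types (K : R) (t : nat).

Definition threshold t : R := ('C(t, 2) + t + 1)%N%:R / (t + 1)%N%:R.

Definition level_spec K t : Prop :=
  (1 <= t)%N /\ threshold t <= K < threshold t.+1.

(* The default value 1 is irrelevant: for K >= 1 some t satisfies level_spec. *)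
Definition level K : nat := xget 1%N [set t | level_spec K t]%classic.

Definition F K : R :=
  let t := level K in
  if K < (t ^ 2 + t + 1)%N%:R / (2 * t)%N%:R
  then 2 ^+ t / ('C(t, 2) + t + 1)%N%:R * K
  else 2 ^+ t.+1 / (t ^ 2 + t + 1)%N%:R * K.

End F.

(* Main.v *)
Require Import Defs.
From HB Require Import structures.
From mathcomp Require Import all_boot all_order all_algebra all_fingroup.
From mathcomp Require Import all_classical all_reals all_analysis.
From mathcomp Require Import zify ring lra.

Set Implicit Arguments.
Unset Strict Implicit.
Unset Printing Implicit Defensive.

Import Order.TTheory GRing.Theory Num.Theory.
Import numFieldNormedType.Exports.

Local Open Scope ring_scope.

(** The upper bound is proved by compression.  An affine basis chosen inside [A]
    gives coordinates in which [A] contains the origin and the unit vectors of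
    a space of [2 ^ d] points ([affine_coordinates]).  For a vector [v] with top
    coordinate [j], compressing along [v] keeps the cardinality and does not
    enlarge the sumset.  When [v] is a unit vector plus a smaller element of the
    set, the origin and the unit vectors stay where they are, so one may assume
    that the set is stable under all these compressions ([compressed_exists]).
    Stability is a strong condition.  If [H] is the largest coordinate subspace,
    spanned by the first coordinates, that a stable set [B] contains, then [B] is
    [H] together with one layer [unit_vec j + A_j] for each of the [m] remaining
    coordinates, where [A_j] is a subset of [H] ([layer_flag]).  The layers are
    decreasing, and each later one acts by translation on the earlier ones.
    Since a layer of more than [2 ^ p] points generates at least [2 ^ p.+1]
    translations, the sizes of the earlier layers are divisible by [2 ^ p.+1]
    ([dvdn_layer]); in particular a pair of layers that is not large is small by
    a definite amount.  The sumset contains the translate by [unit_vec j] of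
    everything below level [j], which bounds it below by a weighted sum of the
    layer sizes ([card_sumset_compressed]).  What remains is an inequality about
    a decreasing sequence of layer sizes ([profile_bound]): Chebyshev's
    inequality, which compares the weighted sum with the plain one, settles it
    except when [t] is [m + 1], the extremal case, where the divisibility is
    used.

    For tightness, take a fixed small set [A0] containing an affine basis of its
    space, and inside the cylinder over [A0] in [r] more dimensions choose a
    subset of any cardinality [c] that still contains an affine basis
    ([cylinder_subset]).  Its sumset stays inside the cylinder over [sumset A0].
    With [c] as small as the doubling constraint permits, the ratio of the span
    to the set tends to [2 ^ d * K / #|sumset A0|] as [r] grows
    ([ratios_dense]).  The two branches of [F] come from two choices of [A0]: the
    origin with the unit vectors ([simplex]), and two parallel copies of a simplex
    with two further independent points ([prism]).

    The growth rate follows because the level [t] is [2 * K] up to a bounded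
    error, and each branch of [F] is [2 ^ t / t ^ 2] times [K] up to bounded
    factors. *)

(** * Layer profiles: the numerical inequality *)

Section Arithmetic.
Local Open Scope nat_scope.

Lemma ge_double_bin j : j ^ 2 + j + 2 <= 2 ^ j.+1.
Proof. by elim: j => [|[|j] IH] //; rewrite (expnS 2); nia. Qed.

(** With [t = m + 2 + j] the last factor on the left is
    [t ^ 2 + 3 * t + 4 - (t + 2) * (m - 1)], the form in which it arises in
    [far_bound].  For fixed [m] the left-hand side divided by [t ^ 2] grows
    only quadratically in [j]. *)
Lemma far_poly m j t : 1 < m -> t = m + 2 + j ->
  (t ^ 2 + t + 2) * (4 * t + 10 + j * (t + 2)) <=
  (t ^ 2 + 3 * t + 4) * ((m + 3) * 2 ^ (j + 2)).
Proof.
move=> m1 tE; have [p pE] : exists p, m = p.+2 by exists (m - 2); lia.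
have e : 2 * (j ^ 2 + j + 2) <= 2 ^ (j + 2).
  by rewrite (addn2 j) (expnS 2) leq_mul2l ge_double_bin.
case: j => [|j] in tE e *.
  by rewrite tE pE; clear; lia.
apply: leq_mul; first by lia.
apply: leq_trans (leq_mul (leqnn _) e); rewrite tE pE; clear; lia.
Qed.

End Arithmetic.

(** In this section [h i] stands for the size of the [i]-th layer above a subspace
    of [H] points, and [m] for the number of layers, so that [H + psum m] is the
    size of the set and [2 ^ m * H] the size of its span. *)
Section Profile.
Local Open Scope nat_scope.
Variable h : nat -> nat.

Definition psum p := \sum_(i < p) h i.
Definition dsum p := \sum_(j < p) psum j.

Lemma psumS p : psum p.+1 = psum p + h p.
Proof. by rewrite /psum big_ord_recr. Qed.

Lemma dsumS p : dsum p.+1 = dsum p + psum p.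
Proof. by rewrite /dsum big_ord_recr. Qed.

Lemma psum0 : psum 0 = 0. Proof. by rewrite /psum big_ord0. Qed.

Lemma dsum0 : dsum 0 = 0. Proof. by rewrite /dsum big_ord0. Qed.

Variables (m H : nat).
Hypothesis h_mono : forall i j, i < j < m -> h j <= h i.

Lemma psum_ge p : p < m -> p * h p <= psum p.
Proof.
elim: p => [|p IH] pm; first by [].
rewrite psumS mulSn addnC leq_add //; last by apply: h_mono; lia.
apply: leq_trans (IH _); last by lia.
by rewrite leq_mul2l h_mono ?orbT; lia.
Qed.

(** Chebyshev's sum inequality: [dsum p] is the sum of the [h i] weighted by
    [p - 1 - i], and both the weights and [h] decrease. *)
Lemma dsum_chebyshev p : p <= m -> p * psum p <= 2 * dsum p + psum p.
Proof.
elim: p => [|p IH] pm; first by [].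
have := IH (ltnW pm); have := psum_ge pm; rewrite psumS dsumS; nia.
Qed.

(** The later of two layers acts on the earlier one, whose size is thus a multiple
    of a power of two not smaller than the later size.  The next three
    hypotheses record the two consequences of this that are used, [h_pair] and
    [h_gap], and that no layer is full. *)
Hypothesis h_pair : forall r i j, i < j < m -> 2 ^ r * h i < H ->
  2 ^ r * (h i + h j) <= H.
Hypothesis h_lt : forall i, i < m -> h i < H.
Hypothesis h_gap : forall i j, i < j < m -> H < 2 * h i ->
  H + 2 * h j <= 2 * h i.

Lemma h_pair0 i j : i < j < m -> h i + h j <= H.
Proof.
move=> ij; have := @h_pair 0 i j ij; rewrite expn0 !mul1n; apply.
by apply: h_lt; lia.
Qed.

(** The first two layers have at most [H] points together, and each later one has
    at most [H / 2]. *)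
Lemma psum_le p : 1 < p <= m -> 2 * psum p <= p * H.
Proof.
elim: p => [|[|[|p]] IH] //.
  by move=> pm; rewrite !psumS psum0; have := @h_pair0 0 1; lia.
move=> pm; rewrite psumS; have := IH _.
by have := @h_pair0 p.+1 p.+2; have := @h_mono p.+1 p.+2; lia.
Qed.

Lemma psum_large p : p <= m -> (forall i, i < p -> H <= 2 * h i) ->
  p * H <= 2 * psum p.
Proof.
elim: p => [|p IH] // pm hp; rewrite psumS.
have := IH (ltnW pm) (fun i ip => hp i (ltnW ip)).
by have := hp p (leqnn _); lia.
Qed.

Lemma dsum_large p : p <= m -> (forall i, i < p -> H <= 2 * h i) ->
  p.+1 * p * H <= 4 * dsum p.+1.
Proof.
elim: p => [|p IH] // pm hp; rewrite dsumS.
have := IH (ltnW pm) (fun i ip => hp i (ltnW ip)).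
by have := psum_large pm hp; nia.
Qed.

Variable s : nat.
Hypothesis s_ge : m.+1 * H + dsum m <= s.

Let a := H + psum m.

(** The doubling is at least the threshold of level [m + 1], so the level [t] of
    such a set satisfies [m < t]. *)
Lemma doubling_ge : 1 < m -> (m ^ 2 + 3 * m + 4) * a <= 2 * (m + 2) * s.
Proof.
move=> m1; have B := @dsum_chebyshev m (leqnn _); have A := @psum_le m.
rewrite m1 leqnn in A; have {}A := A isT.
rewrite /a; move: s_ge A B; move: (psum m) (dsum m) => X T S A B.
have {}A := leq_mul (leqnn (m + 3)) A; have {}B := leq_mul (leqnn (m + 2)) B.
have C := leq_mul (leqnn (2 * (m + 2))) S; nia.
Qed.

(** Chebyshev's inequality alone suffices from [t = m + 2] on: if the sumset were
    too small, so would the layers be, and the doubling would be too large. *)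
Lemma far_bound t : 1 < m -> m + 2 <= t ->
  2 * (t + 2) * s < (t ^ 2 + 3 * t + 4) * a ->
  2 ^ m * H * (t ^ 2 + t + 2) <= 2 ^ t.+1 * s.
Proof.
move=> m1 mt; rewrite ltnNge => /negP lt_s; rewrite leqNgt; apply/negP => s_lt.
case: lt_s; have [j tE] : exists j, t = (m + 2 + j).
  by exists (t - (m + 2)); lia.
have := far_poly m1 tE.
move: s_lt; rewrite tE -mulnA (_ : (m + 2 + j).+1 = m + (j + 2).+1); last by lia.
rewrite expnD -mulnA ltn_pmul2l ?expn_gt0// -tE.
rewrite (expnS 2 (j + 2)); move: (2 ^ (j + 2)) => w s_lt poly.
have B := @dsum_chebyshev m (leqnn _).
have Q : t ^ 2 + 3 * t + 4 = 4 * t + 10 + j * (t + 2) + (t + 2) * (m - 1).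
  have [p pE] : exists p, m = p.+1 by exists m.-1; lia.
  by rewrite tE pE subn1 /=; clear; lia.
have w0 : 0 < w by case: w s_lt poly => // _; rewrite !muln0; lia.
(* Here q = c - (t + 2) (m - 1).  A small s gives 2 s q <= c (m + 3) H; with
   Chebyshev's inequality this brings the doubling up to the threshold. *)
move: Q poly s_lt; rewrite (addnC (4 * t)).
set q := (_ + j * _); set b := (t ^ 2 + t + 2); set c := (t ^ 2 + 3 * t + 4).
move=> Q poly s_lt.
have E1 : w * (2 * (s * q)) <= w * (c * (m + 3) * H).
  have := leq_mul (ltnW s_lt) (leqnn q); have := leq_mul poly (leqnn H).
  by clear; lia.
have {}E1 : 2 * (s * q) <= c * (m + 3) * H by rewrite leq_pmul2l in E1.
rewrite -(@leq_pmul2l (m - 1)); last by lia.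
rewrite /a; move: s_ge B; move: (psum m) (dsum m) => X T S B.
have E2 : (m - 1) * X + 2 * m.+1 * H <= 2 * s by rewrite mulnBl mul1n; lia.
have {}E2 := leq_mul (leqnn c) E2.
rewrite mulnDr in E2; have {}Q := congr1 (muln (2 * s)) Q.
have mE : m = (m - 1).+1 by lia.
move: (m - 1) mE E1 E2 Q => p ->; clearbody c q; clear; lia.
Qed.

Lemma half_psum_le p : p <= m -> (p = 1 -> 2 * h 0 <= H) ->
  2 * psum p <= p * H.
Proof.
case: p => [|[|p]] pm h0; first by rewrite psum0.
  by rewrite psumS psum0 mul1n; apply: h0.
by apply: psum_le; rewrite pm.
Qed.

(** The case [t = m + 1] below the middle point of the level.  If the last but one
    layer had at least [H / 2] points, then so would all earlier ones, and the
    sumset would already be large enough.  Otherwise the last two layers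
    together have at most [H / 2] points; with Chebyshev's inequality on the
    other layers this forces the doubling up to the middle point.  Equality is
    possible, hence the exact multipliers below. *)
Lemma near_bound_low : 1 < m ->
  2 * (m + 1) * s < (m ^ 2 + 3 * m + 3) * a ->
  (m ^ 2 + 3 * m + 4) * H <= 4 * s.
Proof.
move=> m1; rewrite ltnNge => /negP lt_s; rewrite leqNgt; apply/negP => s_lt.
case: lt_s; have [p pE] : exists p, m = p.+2 by exists (m - 2); lia.
have pm : p.+1 <= m by rewrite pE.
have hp2 : 2 * h p < H.
  rewrite ltnNge; apply/negP => hp.
  have /(dsum_large pm) : forall i, (i < p.+1 -> H <= 2 * h i).
    move=> i ip; apply: leq_trans hp _; rewrite leq_mul2l /=.
    by have [->//|/eqP ne] := eqVneq i p; apply: h_mono; lia.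
  by move: s_ge s_lt; rewrite -pE pE; clear; move: (dsum p.+2) => T; lia.
have hp01 : 2 * (h p + h p.+1) <= H.
  by have := @h_pair 1 p p.+1; rewrite expn1 pE !ltnSn; apply.
have hpp : h p.+1 <= h p by apply: h_mono; rewrite pE !ltnSn.
have S := s_ge; rewrite pE !dsumS psumS in S s_lt.
(* With three layers, the first one may exceed H / 2; the gap estimate then bounds
   the second one by H / 6. *)
have [/andP[/eqP p1 h0]|h0] := boolP ((p == 1) && (H < 2 * h 0)).
  have := @h_gap 0 1; have := @h_pair0 0 1; rewrite pE p1 => /(_ isT) g1 /(_ isT h0) g2.
  move: S s_lt hp01 hpp; rewrite /a pE p1 !psumS !dsumS !psum0 dsum0.
  by clear -g1 g2; lia.
have {}h0 : 2 * psum p <= p * H.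
  apply: half_psum_le; first by rewrite pE; lia.
  by move=> p1; move: h0; rewrite p1 /= -leqNgt.
have C := @dsum_chebyshev p; rewrite pE leqW ?leqnSn// in C; have {}C := C isT.
rewrite /a pE !psumS.
move: S C h0 hpp hp01 {s_lt hp2}; move: (psum p) (dsum p) (h p) (h p.+1).
clear => X T h1 h2 S C h0 hpp hp01.
(* The goal is the sum of these five inequalities. *)
have {}S := leq_mul (leqnn (2 * (p + 3))) S.
have {}C := leq_mul (leqnn (p + 3)) C.
have {}h0 := leq_mul (leqnn (p + 4)) h0.
have {}hpp := leq_mul (leqnn (p + 3)) hpp.
have {}hp01 := leq_mul (leqnn (p.+2 ^ 2 + 2 * p.+2 + 2)) hp01.
lia.
Qed.

Lemma psum_leS p : p <= m -> 2 * psum p <= p.+1 * H.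
Proof.
case: p => [|[|p]] pm; first by rewrite psum0.
  by rewrite psumS psum0 leq_mul2l ltnW ?h_lt.
by apply: leq_trans (psum_le _) _; rewrite ?pm // leq_mul2r leqnSn orbT.
Qed.

(** The case [t = m + 1] on the whole level, with a conclusion weaker by [H / 4].
    If the layers before the last two have at least [H / 2] points each, the last
    but one has fewer than [H / 4] (else the sumset is large enough), and
    the last two together have at most [H / 4].  Otherwise any two of the last
    three layers have at most [H / 2] points together, hence all three at most
    [3 * H / 4].  Chebyshev's inequality on the remaining layers concludes. *)
Lemma near_bound : 1 < m ->
  2 * (m + 3) * s < (m ^ 2 + 5 * m + 8) * a ->
  (m ^ 2 + 3 * m + 3) * H <= 4 * s.
Proof.
move=> m1; rewrite ltnNge => /negP lt_s; rewrite leqNgt; apply/negP => s_lt.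
case: lt_s; have [p pE] : exists p, m = p.+2 by exists (m - 2); lia.
have pm : p <= m by rewrite pE; lia.
have hpp : h p.+1 <= h p by apply: h_mono; rewrite pE !ltnSn.
have S := s_ge; rewrite pE in S s_lt.
have [large|[q [pq hq]]] : (forall i, (i < p -> H <= 2 * h i)) \/
    exists q, p = q.+1 /\ (2 * h q < H).
  case: p pE pm {hpp S s_lt} => [|q] pE pm; first by left.
  have [hq|hq] := leqP H (2 * h q); last by right; exists q.
  left=> i iq; apply: leq_trans hq _; rewrite leq_mul2l /=.
  by have [->//|/eqP ne] := eqVneq i q; apply: h_mono; lia.
- have hp4 : 4 * h p < H.
    rewrite ltnNge; apply/negP => hp.
    have := dsum_large pm large; have := psum_large pm large.
    by move: S s_lt hp; rewrite !dsumS psumS; clear; lia.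
  have hp01 : 4 * (h p + h p.+1) <= H.
    by apply: (@h_pair 2 p p.+1) => //; rewrite pE !ltnSn.
  have X_le := psum_leS pm; have C := dsum_chebyshev pm.
  rewrite /a pE !psumS; rewrite !dsumS psumS in S.
  move: S C X_le hpp hp01; move: (psum p) (dsum p) (h p) (h p.+1).
  clear => X T h1 h2 S C X_le hpp hp01.
  have {}S := leq_mul (leqnn (2 * (p + 5))) S.
  have {}C := leq_mul (leqnn (p + 5)) C.
  have {}X_le := leq_mul (leqnn (p + 7)) X_le.
  have {}hpp := leq_mul (leqnn (p + 5)) hpp.
  have {}hp01 := leq_mul (leqnn (p.+2 ^ 2 + 4 * p.+2 + 5)) hp01.
  have e : 0 <= p.+2 ^ 2 * H by [].
  by lia.
- have qm : q.+2 < m by rewrite pE pq.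
  have w1 : 2 * (h q + h q.+1) <= H by apply: (@h_pair 1) => //; lia.
  have w2 : 2 * (h q + h q.+2) <= H by apply: (@h_pair 1) => //; lia.
  have w3 : 2 * (h q.+1 + h q.+2) <= H.
    apply: (@h_pair 1); first by lia.
    by apply: leq_ltn_trans hq; rewrite leq_mul2l h_mono //; lia.
  have hqq : h q.+2 <= h q by apply: h_mono; lia.
  have qm' : (q <= m) by lia.
  have X_le := psum_leS qm'; have C := dsum_chebyshev qm'.
  rewrite /a pE !psumS pq !psumS; rewrite !dsumS psumS pq !dsumS !psumS in S.
  move: S C X_le hqq w1 w2 w3.
  move: (psum q) (dsum q) (h q) (h q.+1) (h q.+2).
  clear => X T h1 h2 h3 S C X_le hqq w1 w2 w3.
  have {w1 w2} W : (4 * (h1 + h2 + h3) <= 3 * H) by lia.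
  have {}S := leq_mul (leqnn (2 * (q + 6))) S.
  have {}C := leq_mul (leqnn (q + 6)) C.
  have {}W := leq_mul (leqnn (q.+3 ^ 2 + 3 * q.+3 + 2)) W.
  have {}hqq := leq_mul (leqnn (2 * (q + 6))) hqq.
  have e : 0 <= q ^ 2 * H by [].
  by lia.
Qed.

(** The proof is by comparing [t] with the number [m] of layers.  At most one layer:
    the sumset fills the span.  [t <= m]: the doubling is too large.
    [t = m + 1]: the extremal case.  [m + 2 <= t]: far from extremal. *)
Lemma profile_bound t : 0 < t ->
  2 * (t + 2) * s < (t ^ 2 + 3 * t + 4) * a ->
  2 ^ m * H * (t ^ 2 + t + 1) <= 2 ^ t.+1 * s /\
  (2 * t * s < (t ^ 2 + t + 1) * a ->
   2 ^ m * H * (t ^ 2 + t + 2) <= 2 ^ t.+1 * s).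
Proof.
move=> t0 s_lt.
suff : (2 ^ m * H * (t ^ 2 + t + 2) <= 2 ^ t.+1 * s \/ m.+1 = t /\ 1 < m).
  case=> [le|[mt m1]]; first split=> //.
    by apply: leq_trans le; rewrite leq_mul2l leq_add2l orbT.
  rewrite -mt (expnD 2 2 m) -(mulnC (2 ^ m)) -!mulnA !leq_pmul2l ?expn_gt0//.
  rewrite -mt in s_lt; split=> [|lt].
  - have := near_bound m1; move: s_lt; clearbody a; clear.
    by rewrite (_ : m.+1 ^ 2 + 3 * m.+1 + 4 = m ^ 2 + 5 * m + 8); lia.
  - have := near_bound_low m1; move: lt; clearbody a; clear.
    by rewrite (_ : m.+1 ^ 2 + m.+1 + 1 = m ^ 2 + 3 * m + 3); lia.
have [m1|m1] := leqP m 1.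
  left; have le : 2 ^ m * H <= s.
    apply: leq_trans s_ge; rewrite -[X in (X <= _)]addn0 leq_add // leq_mul2r.
    by case: (m) m1 => [|[|]] //; rewrite orbT.
  by rewrite mulnC leq_mul // ge_double_bin.
have [tm|mt] := leqP t m; last first.
  move: mt; rewrite leq_eqVlt => /orP[/eqP mt|mt]; first by right.
  by left; apply: far_bound => //; rewrite addn2.
have := doubling_ge m1 => le.
have [d dE] : exists d, m = (t + d) by exists (m - t); lia.
have {}le := leq_mul (leqnn (t + 2)) le.
have {}s_lt : (m + 2) * (2 * (t + 2) * s) < (m + 2) * ((t ^ 2 + 3 * t + 4) * a).
  by rewrite ltn_pmul2l // addn2.
have cross : (t ^ 2 + 3 * t + 4) * (m + 2) <= (m ^ 2 + 3 * m + 4) * (t + 2).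
  by rewrite dE; clear; nia.
have {}cross := leq_mul cross (leqnn a).
by move: le s_lt cross; clearbody a; clear; lia.
Qed.

End Profile.

(** * Compressions *)

Section BinaryVectors.
Import fintype boot.finset.
Variable d : nat.
Local Notation V := 'rV['F_2]_d.
Implicit Types (x y z v w : V) (A B : {set V}).

Lemma F2_cases (c : 'F_2) : (c == 0) || (c == 1).
Proof. by case: c => [[|[|m]] hm]. Qed.

Lemma addVV x : x + x = 0.
Proof.
apply/rowP => i; rewrite !mxE.
by case/orP: (F2_cases (x ord0 i)) => /eqP ->; [rewrite addr0 | apply/eqP].
Qed.

Lemma addVK x y : y + x + x = y.
Proof. by rewrite -addrA addVV addr0. Qed.

Lemma addVKC x y : x + (x + y) = y.
Proof. by rewrite addrA addVV add0r. Qed.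

(** Coordinates indexed by natural numbers, [false] from [d] on, so that the
    subspaces below can be handled without bounded indices. *)
Definition bit x (j : nat) : bool := [exists i : 'I_d, (i == j :> nat) && (x ord0 i != 0)].

Lemma bit_ord x (i : 'I_d) : bit x i = (x ord0 i != 0).
Proof.
apply/existsP/idP => [[k /andP[/eqP/val_inj -> //]]|xi].
by exists i; rewrite eqxx.
Qed.

Lemma bit_lt x j : bit x j -> (j < d)%N.
Proof. by case/existsP => i /andP[/eqP <-]. Qed.

Lemma bit_ge x j : (d <= j)%N -> bit x j = false.
Proof. by move=> dj; apply/negbTE/negP => /bit_lt; rewrite ltnNge dj. Qed.

Lemma bit_inj x y : (forall j, bit x j = bit y j) -> x = y.
Proof.
move=> xy; apply/rowP => i; have := xy i; rewrite !bit_ord.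
by case/orP: (F2_cases (x ord0 i)) => /eqP ->;
   case/orP: (F2_cases (y ord0 i)) => /eqP ->.
Qed.

Lemma bitD x y j : bit (x + y) j = bit x j (+) bit y j.
Proof.
have [jd|jd] := ltnP j d; last first.
  by rewrite !bit_ge.
rewrite -[j]/(val (Ordinal jd)) !bit_ord mxE.
by case/orP: (F2_cases (x ord0 (Ordinal jd))) => /eqP ->;
   case/orP: (F2_cases (y ord0 (Ordinal jd))) => /eqP ->.
Qed.

Lemma bit0 j : bit 0 j = false.
Proof. by apply/negbTE/existsPn => i; rewrite mxE eqxx andbF. Qed.

Definition unit_vec (j : nat) : V := \row_i (i == j :> nat)%:R.

Lemma bit_unit i j : bit (unit_vec i) j = (i == j) && (j < d)%N.
Proof.
have [jd|jd] := ltnP j d; last first.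
  by rewrite andbF bit_ge.
by rewrite -[j]/(val (Ordinal jd)) bit_ord mxE (eq_sym i) andbT; case: (_ == i).
Qed.

Definition flag (j : nat) : {set V} :=
  [set x | [forall i : 'I_d, bit x i ==> (i < j)%N]].

Lemma flagP j x : reflect (forall i, bit x i -> (i < j)%N) (x \in flag j).
Proof.
rewrite inE; apply: (iffP forallP) => [h i xi|h i]; last exact/implyP/h.
by have := h (Ordinal (bit_lt xi)); rewrite xi.
Qed.

Lemma flag0 j : 0 \in flag j.
Proof. by apply/flagP => i; rewrite bit0. Qed.

Lemma flagD j x y : x \in flag j -> y \in flag j -> x + y \in flag j.
Proof.
move=> /flagP xj /flagP yj; apply/flagP => i; rewrite bitD.
by case: (boolP (bit x i)) => [/xj //|_ /yj].
Qed.

Lemma flagS i j x : (i <= j)%N -> x \in flag i -> x \in flag j.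
Proof. by move=> ij /flagP xi; apply/flagP => l /xi /leq_trans; apply. Qed.

Lemma flag_unit i j : (i < j)%N -> unit_vec i \in flag j.
Proof. by move=> ij; apply/flagP => l; rewrite bit_unit => /andP[/eqP <-]. Qed.

Lemma flag_ge i j x : x \in flag j -> (j <= i)%N -> bit x i = false.
Proof.
by move=> /flagP xj ji; apply/negbTE/negP => /xj; rewrite ltnNge ji.
Qed.

Lemma flag_all x : x \in flag d.
Proof. by apply/flagP => i /bit_lt. Qed.

(** Each line in the direction [v] that meets [B] in a single point, lying in the
    half space [bit x j], has that point moved to the other half space. *)
Definition shift B j v x := if bit x j && (x + v \notin B) then x + v else x.

Definition compress B j v := [set shift B j v x | x in B].

Lemma mem_compress B j v x : bit v j -> (x \in compress B j v) =
  if bit x j then (x \in B) && (x + v \in B) else (x \in B) || (x + v \in B).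
Proof.
move=> vj; apply/imsetP/idP => [[y yB ->]|].
  rewrite /shift; have [/andP[yj yv]|] := boolP (bit y j && (y + v \notin B)).
    by rewrite bitD yj vj /= addVK yB orbT.
  by rewrite yB negb_and negbK; case: (bit y j).
case: ifP => xj; first by case/andP=> xB xvB; exists x; rewrite // /shift xvB andbF.
have [xB _|xB /= xvB] := boolP (x \in B); first by exists x; rewrite // /shift xj.
by exists (x + v); rewrite // /shift bitD xj vj addVK xB.
Qed.

Lemma shift_inj B j v : {in B &, injective (shift B j v)}.
Proof.
move=> x y xB yB; rewrite /shift.
case: ifP => [/andP[xj xv]|_]; case: ifP => [/andP[yj yv]|_] //.
- by move=> /(congr1 (+%R^~ v)); rewrite !addVK.
- by move=> e; rewrite e yB in xv.
- by move=> e; rewrite -e xB in yv.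
Qed.

Lemma card_compress B j v : #|compress B j v| = #|B|.
Proof. by rewrite card_in_imset //; apply: shift_inj. Qed.

Lemma mem_sumset A x y : x \in A -> y \in A -> x + y \in sumset A.
Proof. by move=> xA yA; apply/imset2P; exists x y. Qed.

(** On each pair of points [x, x + v] a compressed set is determined by how many
    of them lie in the original set.  A pair meeting [B] once contributes its
    point with [bit x j = false], a full pair contributes both points; adding
    a nonempty pair to a full pair gives a full pair of the sumset. *)
Lemma sumset_compress B j v : bit v j ->
  sumset (compress B j v) \subset compress (sumset B) j v.
Proof.
move=> vj; apply/subsetP => z /imset2P[x y xC yC ->{z}].
move: xC yC; rewrite !mem_compress // bitD.
have eq1 : x + y + v = (x + v) + y by rewrite addrAC.
have eq2 : x + y + v = x + (y + v) by rewrite addrA.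
have eq3 : x + y = x + v + (y + v) by rewrite addrACA addVV addr0.
case: (bit x j); case: (bit y j) => /=.
- by move=> /andP[xB _] /andP[yB _]; rewrite mem_sumset.
- by move=> /andP[xB xvB] /orP[yB|yvB];
     [rewrite eq1 | rewrite eq2 [in X in X && _]eq3]; rewrite !mem_sumset.
- by move=> /orP[xB|xvB] /andP[yB yvB];
     [rewrite eq2 | rewrite eq1 [in X in X && _]eq3]; rewrite !mem_sumset.
- case/orP=> [xB|xvB] /orP[yB|yvB].
  + by rewrite mem_sumset.
  + by rewrite eq2 [X in _ || X]mem_sumset ?orbT.
  + by rewrite eq1 [X in _ || X]mem_sumset ?orbT.
  + by rewrite eq3 mem_sumset.
Qed.

Definition binval x := (\sum_(i < d) bit x i * 2 ^ i)%N.

Lemma binary_lt n (f : nat -> bool) : (\sum_(i < n) f i * 2 ^ i < 2 ^ n)%N.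
Proof.
elim: n => [|n IH]; first by rewrite big_ord0.
rewrite big_ord_recr /= expnS mul2n -addnn -addSn leq_add //.
by case: (f n); rewrite ?mul1n.
Qed.

Lemma binary_mono n j (f g : nat -> bool) : (j < n)%N ->
  (forall i, (j < i)%N -> f i = g i) -> f j = false -> g j ->
  (\sum_(i < n) f i * 2 ^ i < \sum_(i < n) g i * 2 ^ i)%N.
Proof.
elim: n => // n IH; rewrite ltnS leq_eqVlt => /orP[/eqP <-|jn] fg fj gj.
  rewrite !big_ord_recr /= fj gj addn0 mul1n.
  by apply: leq_trans (binary_lt _ _) _; rewrite leq_addl.
by rewrite !big_ord_recr /= fg // ltn_add2r; apply: IH.
Qed.

(** Adding [v] switches off the coordinate [j] and changes only smaller ones. *)
Lemma binval_shift j v x : (j < d)%N -> bit v j -> v \in flag j.+1 -> bit x j ->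
  (binval (x + v) < binval x)%N.
Proof.
move=> jd vj vf xj; apply: (binary_mono jd) => // [i ji|].
  by rewrite bitD (flag_ge vf) ?addbF.
by rewrite bitD xj vj.
Qed.

(** A compression along [unit_vec j + w] decreases the binary value of every point
    that it moves, so a set of least total binary value is fixed by all of these
    compressions.  They keep the origin and the unit vectors in place: the only
    one that could move is [unit_vec j], and its partner [w] is in the set. *)
Lemma compressed_exists A : 0 \in A -> (forall j, (j < d)%N -> unit_vec j \in A) ->
  exists B, [/\ 0 \in B, forall j, (j < d)%N -> unit_vec j \in B,
    #|B| = #|A|, (#|sumset B| <= #|sumset A|)%N &
    forall j w x, w \in B -> w \in flag j -> x \in B -> bit x j ->
      x + (unit_vec j + w) \in B].
Proof.
move=> A0 Ae; pose good B := [&& 0 \in B, [forall j : 'I_d, unit_vec j \in B],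
  #|B| == #|A| & (#|sumset B| <= #|sumset A|)%N].
have goodA : good A.
  by rewrite /good A0 eqxx leqnn !andbT; apply/forallP => j; apply: Ae.
pose weight B := (\sum_(x in B) binval x)%N.
have [B /and4P[B0 /forallP Be /eqP cB sB] minB] :=
  @arg_minnP _ A good weight goodA.
have Be' j : (j < d)%N -> unit_vec j \in B by move=> jd; apply: (Be (Ordinal jd)).
exists B; split=> // j w x wB wj xB xj.
have jd := bit_lt xj; set v := unit_vec j + w.
have vj : bit v j by rewrite bitD bit_unit eqxx jd (flag_ge wj).
have vf : v \in flag j.+1.
  by rewrite flagD ?flag_unit// (flagS _ wj).
apply/negPn/negP => xvB; set C := compress B j v.
have : (weight C < weight B)%N.
  rewrite /weight (big_imset _ (@shift_inj B j v)) /= (bigD1 x) //=.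
  rewrite [X in (_ < X)%N](bigD1 x) //= -addSn leq_add //.
    by rewrite /shift xj xvB (binval_shift jd).
  apply: leq_sum => y _; rewrite /shift; case: ifP => // /andP[yj _].
  by apply/ltnW/(binval_shift jd).
rewrite ltnNge => /negP; apply; apply: minB; apply/and4P; split.
- by rewrite mem_compress // bit0 B0.
- apply/forallP => i; rewrite mem_compress // bit_unit jd andbT Be.
  by case: eqP => //= ->; rewrite /v addrA addVV add0r.
- by rewrite card_compress cB.
- apply: leq_trans (subset_leq_card (sumset_compress B vj)) _.
  by rewrite card_compress.
Qed.

End BinaryVectors.

(** * The structure of compressed sets *)

Section CompressedSets.
Import fintype boot.finset.
Local Open Scope nat_scope.
Variable d : nat.
Local Notation V := 'rV['F_2]_d.
Implicit Types (x y z u w : V) (S : {set V}).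

Lemma flag_bitS y i : y \in flag d i.+1 ->
  if bit y i then (unit_vec d i + y)%R \in flag d i else y \in flag d i.
Proof.
move=> yi; case: ifP => yb; apply/flagP => l; last first.
  move=> yl; move/flagP: yi => /(_ l yl); rewrite ltnS leq_eqVlt.
  by case/orP=> // /eqP e; rewrite e yb in yl.
rewrite bitD bit_unit; case: eqP => [<-|ne] /=.
  by rewrite (bit_lt yb) yb.
move/flagP: yi => yi /yi; rewrite ltnS leq_eqVlt eq_sym.
by case/orP=> // /eqP.
Qed.

Lemma top_bit k y : y \notin flag d k ->
  exists i, [/\ k <= i, bit y i & (unit_vec d i + y)%R \in flag d i].
Proof.
move=> yk; have ex : exists n, y \in flag d n by exists d; apply: flag_all.
case: (ex_minnP ex) => n yn minn.
case: n => [|i] in yn minn *; first by rewrite (flagS _ yn) in yk.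
have := flag_bitS yn; case: ifP => yb yi.
  exists i; split=> //; rewrite leqNgt; apply: contra yk => ik.
  exact: flagS yn.
by have := minn _ yi; rewrite ltnn.
Qed.

(** The points of [S] with top coordinate [j], with that coordinate removed. *)
Definition layer S j := [set y in flag d j | (unit_vec d j + y)%R \in S].

Lemma mem_layer S j y :
  (y \in layer S j) = (y \in flag d j) && ((unit_vec d j + y)%R \in S).
Proof. by rewrite !inE. Qed.

Lemma card_flagS S j : j < d ->
  #|S :&: flag d j.+1| = #|S :&: flag d j| + #|layer S j|.
Proof.
move=> jd; rewrite -(cardsID (flag d j)); congr (_ + _).
  apply: eq_card => x; rewrite !in_setI -andbA.
  by case: (boolP (x \in flag d j)) => xj; rewrite ?andbF // (flagS _ xj).
rewrite -(card_imset (layer S j) (addrI (unit_vec d j))).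
apply: eq_card => x; rewrite in_setD in_setI; apply/and3P/imsetP.
  case=> xj xS xj1; have := flag_bitS xj1;
    case: ifP => [_ x'|_ xj']; last by rewrite xj' in xj.
  exists (unit_vec d j + x)%R; last by rewrite addVKC.
  by rewrite mem_layer x' addVKC.
case=> y; rewrite mem_layer => /andP[yj yS] ->; split=> //.
  by apply/negP => /(flag_ge)/(_ (leqnn j)); rewrite bitD bit_unit eqxx jd (flag_ge yj).
by rewrite flagD ?flag_unit // (flagS _ yj).
Qed.

Lemma card_flag_add S k p : k + p <= d ->
  #|S :&: flag d (k + p)| = #|S :&: flag d k| + psum (fun i => #|layer S (k + i)|) p.
Proof.
elim: p => [|p IH] kp; first by rewrite addn0 psum0 addn0.
by rewrite addnS card_flagS ?IH ?psumS ?addnA //; move: kp; rewrite addnS // => /ltnW.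
Qed.

Lemma card_flag k : k <= d -> #|flag d k| = 2 ^ k.
Proof.
elim: k => [|k IH] kd.
  apply/eqP/cards1P; exists (0%R : V); apply/setP => x.
  rewrite in_set1; apply/idP/eqP => [x0|->]; last exact: flag0.
  by apply: bit_inj => j; rewrite bit0 (flag_ge x0).
have := card_flagS [set: V] kd; rewrite !setTI => ->.
have -> : layer [set: V] k = flag d k.
  by apply/setP => x; rewrite mem_layer in_setT andbT.
by rewrite IH ?expnS ?mul2n ?addnn // ltnW.
Qed.

Lemma flag_group_set k : group_set (flag d k).
Proof. by apply/group_setP; split=> [|x y]; [exact: flag0 | exact: flagD]. Qed.

(** [S] is a union of cosets of [G]. *)
Lemma dvdn_card_invariant (G : {group V}) S :
  (forall g x, g \in G -> x \in S -> (g + x)%R \in S) -> #|G| %| #|S|.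
Proof.
move=> GS; have actsG : [acts G, on S | 'R].
  apply/subsetP => g gG; rewrite !inE /=; apply/subsetP => x xS.
  by rewrite inE /= -[(x * g)%g]/(x + g)%R addrC GS.
have card_orb O : O \in orbit 'R G @: S -> #|O| = #|G|.
  by case/imsetP => x _ ->; rewrite orbitR card_lcoset.
by rewrite (card_uniform_partition card_orb (orbit_partition actsG)) dvdn_mull.
Qed.

Variable B : {set V}.
Hypothesis B0 : 0%R \in B.
Hypothesis Be : forall j, j < d -> unit_vec d j \in B.
Hypothesis Bst : forall j w x, w \in B -> w \in flag d j -> x \in B ->
  bit x j -> (x + (unit_vec d j + w))%R \in B.

Lemma layer_shift j y w : j < d -> y \in layer B j -> w \in B -> w \in flag d j ->
  (y + w)%R \in B.
Proof.
move=> jd; rewrite mem_layer => /andP[yj yB] wB wj.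
have := Bst wB wj yB; rewrite bitD bit_unit eqxx jd (flag_ge yj) //= => /(_ isT).
by rewrite addrACA addVV add0r.
Qed.

Variable k : nat.
Hypothesis kd : k < d.
Hypothesis flagB : flag d k \subset B.
Hypothesis k_max : ~~ (flag d k.+1 \subset B).

(** Consider a point [y] of a layer with top coordinate [i] at or above [k]; then
    [y] is in [B], and so is [y + w] for every [w] of [B] below the layer.  If
    [i = k], these points fill [flag k.+1], against the maximality of [k].  If
    [k < i], then [y + unit_vec k] is a point with top coordinate [i] and a
    further coordinate [k], which the induction hypothesis at [i] excludes. *)
Lemma layer_flag j : k <= j -> j < d -> layer B j \subset flag d k.
Proof.
elim/ltn_ind: j => j IH kj jd; apply/subsetP => y yA.
apply/negPn/negP => /top_bit [i [ki yi yi']].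
have yB : y \in B by have := layer_shift jd yA B0 (flag0 _ _); rewrite addr0.
have /andP[yj _] : (y \in flag d j) && ((unit_vec d j + y)%R \in B) by rewrite -mem_layer.
have ij : i < j by move/flagP: yj; apply.
have y'k : (unit_vec d i + y)%R \in flag d k.
  move/subsetP: (IH i ij ki (ltn_trans ij jd)); apply.
  by rewrite mem_layer yi' addVKC.
move: ki; rewrite leq_eqVlt => /orP[/eqP ki|ki].
  case/negP: k_max; apply/subsetP => z zk1; have := flag_bitS zk1.
  case: ifP => zk z'; last by move/subsetP: flagB; apply.
  have wk : ((unit_vec d i + y) + (unit_vec d k + z))%R \in flag d k by rewrite flagD.
  have := layer_shift jd yA (subsetP flagB _ wk) (flagS kj wk).
  by rewrite -ki addrACA addVV add0r addVKC.
have ekB := Be kd.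
have := layer_shift jd yA ekB (flag_unit _ (leq_trans ki (ltnW ij))) => ykB.
have : (unit_vec d i + y + unit_vec d k)%R \in layer B i.
  by rewrite mem_layer flagD ?flag_unit //= -addrA addVKC.
move/(subsetP (IH i ij (ltnW ki) (ltn_trans ij jd))).
by move/(flag_ge)/(_ (leqnn k)); rewrite bitD (flag_ge y'k) // bit_unit eqxx kd.
Qed.

Lemma layer0 j : j < d -> 0%R \in layer B j.
Proof. by move=> jd; rewrite mem_layer flag0 addr0 Be. Qed.

Lemma layer_add i j y u : k <= i -> i < j -> j < d ->
  y \in layer B j -> u \in layer B i -> (y + u)%R \in layer B i.
Proof.
move=> ki ij jd yA uA; have yk := subsetP (layer_flag (ltnW (leq_ltn_trans ki ij)) jd) _ yA.
move: uA; rewrite !mem_layer => /andP[ui uB].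
rewrite flagD ?(flagS ki yk) //=.
have := layer_shift jd yA uB; rewrite addrCA; apply.
by rewrite flagD ?flag_unit // (flagS (ltnW ij)).
Qed.

Lemma layer_sub i j : k <= i -> i < j -> j < d -> layer B j \subset layer B i.
Proof.
move=> ki ij jd; apply/subsetP => y yA; rewrite -[y]addr0.
by apply: (layer_add ki ij jd) => //; apply: layer0; apply: ltn_trans jd.
Qed.

Lemma card_layer_lt j : k <= j -> j < d -> #|layer B j| < 2 ^ k.
Proof.
move=> kj jd; have kA : layer B j \subset layer B k.
  by move: kj; rewrite leq_eqVlt => /orP[/eqP <- //|kj]; apply: layer_sub.
apply: leq_ltn_trans (subset_leq_card kA) _; rewrite -(card_flag (ltnW kd)).
apply: proper_card; rewrite properE layer_flag //=.
apply: contra k_max => kA'; apply/subsetP => z /flag_bitS; case: ifP => zb zk.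
  by have := subsetP kA' _ zk; rewrite mem_layer addVKC => /andP[].
by apply: (subsetP flagB).
Qed.

(** Compressions at coordinates below [k] make the layers closed under passing to
    smaller binary values. *)
Lemma layer_down j l y w : k <= j -> j < d -> l < k -> y \in layer B j ->
  bit y l -> w \in flag d l -> (y + (unit_vec d l + w))%R \in layer B j.
Proof.
move=> kj jd lk yA yl wl; have yk := subsetP (layer_flag kj jd) _ yA.
have wk := flagS (ltnW lk) wl.
move: yA; rewrite !mem_layer => /andP[yj yB]; apply/andP; split.
  by rewrite !flagD ?flag_unit ?(flagS kj) //; apply: leq_trans kj.
have := Bst (subsetP flagB _ wk) wl yB; rewrite bitD bit_unit yl.
rewrite (gtn_eqF (leq_trans lk kj)) /= => /(_ isT).
by rewrite -addrA.
Qed.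

(** A layer of more than [2 ^ p] points has a point [y] whose top coordinate [l] is
    at least [p].  Being closed downwards, the layer then contains [flag l];
    together with [y] this generates a group containing [flag p.+1], and the
    earlier layer is invariant under translation by it. *)
Lemma dvdn_layer i j p : k <= i -> i < j -> j < d ->
  2 ^ p < #|layer B j| -> 2 ^ p.+1 %| #|layer B i|.
Proof.
move=> ki ij jd pA; have kj : k <= j := ltnW (leq_ltn_trans ki ij).
have pk : p < k.
  have := ltn_trans pA (card_layer_lt kj jd); rewrite ltn_exp2l //.
have pd : p.+1 <= d by apply: leq_trans pk (ltnW kd).
rewrite -(card_flag pd) -[flag d _]/(gval (Group (flag_group_set p.+1))).
apply: dvdn_card_invariant => z u zG uA.
have [y yA yp] : exists2 y, y \in layer B j & y \notin flag d p.
  apply/subsetPn; apply: contraL pA => /subset_leq_card.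
  by rewrite card_flag -?leqNgt // ltnW.
have [l [pl yl yl']] := top_bit yp.
have yk := subsetP (layer_flag kj jd) _ yA.
have lk : l < k by move/flagP: yk; apply.
have low v : v \in flag d l -> v \in layer B j.
  move=> vl; have := layer_down kj jd lk yA yl (flagD yl' vl).
  by rewrite -addrA addVKC addVKC.
have {zG} zp : z \in flag d p.+1 by [].
have [zl|zl] := boolP (z \in flag d l); first exact: layer_add (low _ zl) uA.
have {pl} pl : l = p.
  apply/eqP; rewrite eqn_leq pl andbT leqNgt; apply: contra zl => lt_pl.
  exact: flagS zp.
have zb : bit z l.
  by move: zp; rewrite -pl => /flag_bitS; case: ifP => // _ zl'; rewrite zl' in zl.
have z'l : (unit_vec d l + z)%R \in flag d l.
  by move: zp; rewrite -pl => /flag_bitS; rewrite zb.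
have := layer_add ki ij jd (low _ (flagD z'l yl')) (layer_add ki ij jd yA uA).
by rewrite [X in (X + _)%R]addrACA addVV add0r -addrA addVKC.
Qed.

(** [2 ^ q] is the least power of two that bounds the size of the later layer. *)
Lemma layer_gap i j : k <= i -> i < j -> j < d ->
  exists q n, [/\ #|layer B j| <= 2 ^ q, #|layer B i| = n.+1 * 2 ^ q & q < k].
Proof.
move=> ki ij jd; have id := ltn_trans ij jd.
have A_gt0 : 0 < #|layer B i| by apply/card_gt0P; exists 0%R; apply: layer0.
have ex : exists q, #|layer B j| <= 2 ^ q.
  by exists #|layer B j|; apply/ltnW/ltn_expl.
case: (ex_minnP ex) => q jq minq.
have /dvdnP[n nE] : 2 ^ q %| #|layer B i|.
  case: q => [|p] in jq minq *; first exact: dvd1n.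
  apply: (dvdn_layer ki ij jd); rewrite ltnNge; apply/negP => /minq.
  by rewrite ltnn.
case: n => [|n] in nE *; first by rewrite nE in A_gt0.
exists q, n; split=> //.
have := card_layer_lt ki id; rewrite nE mulSn => /(leq_ltn_trans (leq_addr _ _)).
by rewrite ltn_exp2l.
Qed.

Let h i := #|layer B (k + i)|.
Let m := d - k.

Let kmd : k + m = d. Proof. by rewrite subnKC // ltnW. Qed.

Lemma card_compressed : #|B| = 2 ^ k + psum h m.
Proof.
have := @card_flag_add B k m; rewrite kmd leqnn => /(_ isT).
rewrite (setIidPr flagB) card_flag ?(ltnW kd) // => <-; congr #|pred_of_set _|.
by apply/setP => x; rewrite in_setI flag_all andbT.
Qed.

(** For each coordinate [j], the sumset contains [unit_vec j] plus every point of
    [B] below level [j]. *)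
Lemma card_sumset_compressed : m.+1 * 2 ^ k + dsum h m <= #|sumset B|.
Proof.
have subB : B \subset sumset B.
  by apply/subsetP => x xB; rewrite -[x]addr0 mem_sumset.
have := @card_flag_add (sumset B) k m; rewrite kmd leqnn => /(_ isT).
rewrite (setIidPr (subset_trans flagB subB)) card_flag ?(ltnW kd) //.
rewrite (_ : sumset B :&: flag d d = sumset B); last first.
  by apply/setP => x; rewrite in_setI flag_all andbT.
move=> ->; rewrite mulSn -addnA leq_add2l.
have ge p : p < m -> 2 ^ k + psum h p <= #|layer (sumset B) (k + p)|.
  move=> pm; have kpd : k + p < d by rewrite -kmd ltn_add2l.
  have := card_flag_add B (ltnW kpd); rewrite (setIidPr flagB) card_flag ?(ltnW kd) // => <-.
  apply/subset_leq_card/subsetP => x; rewrite in_setI mem_layer => /andP[xB ->] /=.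
  by rewrite mem_sumset // Be.
elim: {-2}m (leqnn m) => [|p IH] pm; first by rewrite dsum0.
rewrite mulSn psumS dsumS (addnC (2 ^ k)) addnACA.
by apply: leq_add; [exact: IH (ltnW pm) | exact: ge].
Qed.

Lemma compressed_bound t : 0 < t ->
  2 * (t + 2) * #|sumset B| < (t ^ 2 + 3 * t + 4) * #|B| ->
  2 ^ d * (t ^ 2 + t + 1) <= 2 ^ t.+1 * #|sumset B| /\
  (2 * t * #|sumset B| < (t ^ 2 + t + 1) * #|B| ->
   2 ^ d * (t ^ 2 + t + 2) <= 2 ^ t.+1 * #|sumset B|).
Proof.
rewrite card_compressed -[in 2 ^ d]kmd (addnC k) expnD => t0 lt.
apply: (profile_bound (h := h)) lt => //.
- move=> i j /andP[ij jm]; apply/subset_leq_card/layer_sub; rewrite ?leq_addr ?ltn_add2l //.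
  by rewrite -kmd ltn_add2l.
- move=> r i j /andP[ij jm] hi; rewrite /h in hi *.
  have [||| q [n [jq iE qk]]] := @layer_gap (k + i) (k + j);
    rewrite ?leq_addr ?ltn_add2l -?kmd ?ltn_add2l //.
  move: #|layer B (k + j)| jq => hj jq; rewrite iE mulnCA -expnD in hi *.
  have rq : r + q < k.
    rewrite -(@ltn_exp2l 2) //; apply: leq_ltn_trans hi.
    by rewrite mulSn leq_addr.
  move: hi; rewrite mulnDr mulnCA -expnD -(subnK (ltnW rq)).
  rewrite (expnD 2 (k - (r + q))) ltn_pmul2r ?expn_gt0 // => hi.
  apply: leq_trans (leq_mul hi (leqnn _)); rewrite [X in _ <= X]mulSn addnC leq_add2r.
  by rewrite expnD leq_mul2l jq orbT.
- by move=> i im; apply: card_layer_lt; rewrite ?leq_addr // -kmd ltn_add2l.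
- move=> i j /andP[ij jm] hi; rewrite /h in hi *.
  have [||| q [n [jq iE qk]]] := @layer_gap (k + i) (k + j);
    rewrite ?leq_addr ?ltn_add2l -?kmd ?ltn_add2l //.
  move: #|layer B (k + j)| jq => hj jq; move: hi; rewrite iE mulnCA -expnS -(subnK qk).
  rewrite (expnD 2 (k - q.+1)) ltn_pmul2r ?expn_gt0 // => hi.
  apply: leq_trans (leq_mul hi (leqnn _)); rewrite [X in _ <= X]mulSn addnC leq_add2r.
  by rewrite expnS leq_mul2l jq.
- exact: card_sumset_compressed.
Qed.

End CompressedSets.

(** * The upper bound *)

Section Bound.
Import fintype boot.finset.
Local Open Scope nat_scope.

(** The first inequality is the bound of [F] on the upper part of level [t], the
    hypothesis being that the doubling is below the next threshold; the second
    one is its bound on the part below the middle point. *)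
Lemma spanning_bound d (A : {set 'rV['F_2]_d}) t : 0%R \in A ->
  (forall j, j < d -> unit_vec d j \in A) -> 0 < t ->
  2 * (t + 2) * #|sumset A| < (t ^ 2 + 3 * t + 4) * #|A| ->
  2 ^ d * (t ^ 2 + t + 1) <= 2 ^ t.+1 * #|sumset A| /\
  (2 * t * #|sumset A| < (t ^ 2 + t + 1) * #|A| ->
   2 ^ d * (t ^ 2 + t + 2) <= 2 ^ t.+1 * #|sumset A|).
Proof.
move=> A0 Ae t0 lt; have [B [B0 Be cB sB Bst]] := compressed_exists A0 Ae.
have sB' c : c * #|sumset B| <= c * #|sumset A| by rewrite leq_mul2l sB orbT.
suff : 2 ^ d * (t ^ 2 + t + 1) <= 2 ^ t.+1 * #|sumset B| /\
  (2 * t * #|sumset B| < (t ^ 2 + t + 1) * #|B| ->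
   2 ^ d * (t ^ 2 + t + 2) <= 2 ^ t.+1 * #|sumset B|).
  rewrite cB => -[le1 le2]; split=> [|lt2]; first exact: leq_trans le1 (sB' _).
  exact: leq_trans (le2 (leq_ltn_trans (sB' _) lt2)) (sB' _).
(* If B is the whole space then so is its sumset. *)
have [fB|nfB] := boolP (flag d d \subset B).
  have le : 2 ^ d * (t ^ 2 + t + 2) <= 2 ^ t.+1 * #|sumset B|.
    rewrite mulnC; apply: leq_mul; first exact: ge_double_bin.
    rewrite -(card_flag (leqnn d)); apply: subset_leq_card.
    apply/subsetP => x /(subsetP fB) xB.
    by rewrite -[x]addr0 mem_sumset.
  by split=> //; apply: leq_trans le; rewrite leq_mul2l leq_add2l orbT.
have ex : exists n, ~~ (flag d n \subset B) by exists d.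
case: (ex_minnP ex) => n nB minn.
have nd : n <= d by apply: minn.
case: n => [|k] in nB minn nd *.
  have/eqP/cards1P[x ex0] := card_flag nd; case/negP: nB; apply/subsetP => y.
  have := flag0 d 0; rewrite ex0 !in_set1 => /eqP x0 /eqP ->.
  by rewrite -x0.
have flagB : flag d k \subset B.
  by apply/negPn/negP => /minn; rewrite ltnn.
apply: (compressed_bound B0 Be Bst nd flagB nB) => //.
by rewrite cB; apply: leq_ltn_trans (sB' _) lt.
Qed.

(** An affine basis of the span, chosen inside [A], gives coordinates in which
    [A] contains the origin and the unit vectors. *)
Lemma affine_coordinates n (A : {set 'rV['F_2]_n}) : A != set0 ->
  exists d (A' : {set 'rV['F_2]_d}), [/\ 0%R \in A',
    forall j, j < d -> unit_vec d j \in A', #|A'| = #|A|,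
    #|sumset A'| = #|sumset A| & #|affine_span A| <= 2 ^ d].
Proof.
case/set0Pn => a0 aA.
(* The rows of P are a basis of the span of the differences x + a0, chosen among
   them, and f is the affine map from coordinates to points. *)
pose M : 'M['F_2]_(#|A|, n) := (\matrix_i (enum_val i + a0))%R.
pose P := rowsub (maxrankfun M) M.
pose g (y : 'rV['F_2]_(\rank M)) := (y *m P)%R; pose f y := (g y + a0)%R.
have gD y z : (g (y + z) = g y + g z)%R by rewrite /g mulmxDl.
have g_inj : injective g by apply: row_free_inj; apply: maxrowsub_free.
have f_inj : injective f by move=> y z /addIr /g_inj.
have rowM i : row i M = (enum_val i + a0)%R by rewrite rowK.
have imA : A = f @: (f @^-1: A).
  apply/esym/setP => x; apply/imsetP/idP => [[y]|xA]; first by rewrite inE => fy ->.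
  have : (row (enum_rank_in aA x) M <= P)%MS by rewrite eq_maxrowsub row_sub.
  rewrite rowM enum_rankK_in // => /submxP[y xE].
  have xf : x = f y by rewrite /f /g -xE addVK.
  by exists y; rewrite // inE -xf.
exists (\rank M), (f @^-1: A); split.
- by rewrite inE /f /g mul0mx add0r.
- move=> j jd; rewrite inE /f /g.
  have -> : unit_vec (\rank M) j = delta_mx ord0 (Ordinal jd).
    by apply/rowP => i; rewrite !mxE eqxx /=.
  by rewrite -rowE row_rowsub rowM addVK enum_valP.
- by rewrite [in RHS]imA card_imset.
- rewrite -(card_imset _ g_inj); apply: eq_card => z; apply/imsetP/imset2P.
    case=> s /imset2P[x y]; rewrite !inE => xA yA -> ->.
    by exists (f x) (f y); rewrite // gD /f addrACA addVV addr0.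
  case=> x y xA yA ->; move: xA yA; rewrite [in X in X -> _]imA [in X in _ -> X -> _]imA.
  move=> /imsetP[x' x'A ->] /imsetP[y' y'A ->].
  exists (x' + y')%R; first exact: mem_sumset.
  by rewrite gD /f addrACA addVV addr0.
- rewrite -(card_flag (leqnn (\rank M))).
  rewrite -(card_imset _ f_inj); apply: subset_leq_card; apply: affine_span_min; last first.
    by rewrite [in X in X \subset _]imA; apply/imsetS/subsetP => x _; exact: flag_all.
  have gG : group_set (g @: [set: 'rV['F_2]_(\rank M)]).
    apply/group_setP; split; first by apply/imsetP; exists 0%R => //; rewrite /g mul0mx.
    move=> _ _ /imsetP[x _ ->] /imsetP[y _ ->]; apply/imsetP; by exists (x + y)%R.
  apply/existsP; exists (Group gG); apply/rcosetsP; exists a0 => //.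
  apply/setP => z; rewrite mem_rcoset; apply/imsetP/imsetP => -[y _].
    by move=> ->; exists y => //; rewrite /f; apply: addrK.
  move=> e; exists y; first exact: flag_all.
  by rewrite /f -e; apply/esym/addrNK.
Qed.

Lemma affine_bound n (A : {set 'rV['F_2]_n}) t : A != set0 -> 0 < t ->
  2 * (t + 2) * #|sumset A| < (t ^ 2 + 3 * t + 4) * #|A| ->
  #|affine_span A| * (t ^ 2 + t + 1) <= 2 ^ t.+1 * #|sumset A| /\
  (2 * t * #|sumset A| < (t ^ 2 + t + 1) * #|A| ->
   #|affine_span A| * (t ^ 2 + t + 2) <= 2 ^ t.+1 * #|sumset A|).
Proof.
move=> /affine_coordinates[d [A' [A0 Ae <- <- sd]]] t0 lt.
have [le1 le2] := spanning_bound A0 Ae t0 lt.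
split=> [|lt2]; first by apply: leq_trans le1; rewrite leq_mul2r sd orbT.
by apply: leq_trans (le2 lt2); rewrite leq_mul2r sd orbT.
Qed.

End Bound.

(** * Extremal sets *)

Section Constructions.
Import fintype boot.finset.
Local Open Scope nat_scope.

Lemma double_bin2 n : 2 * 'C(n, 2) = n * n.-1.
Proof. by elim: n => // n IH; rewrite binS bin1 mulnDr IH; case: n {IH} => //= n; lia. Qed.

(** In characteristic two all the sums [a + a] coincide. *)
Lemma card_sumset_le n (A : {set 'rV['F_2]_n}) : #|sumset A| <= 'C(#|A|, 2) + 1.
Proof.
pose pairs := [set P : {set 'rV['F_2]_n} | P \subset A & #|P| == 2].
pose total (P : {set 'rV['F_2]_n}) := (\sum_(x in P) x)%R.
have sub : sumset A \subset 0%R |: [set total P | P in pairs].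
  apply/subsetP => z /imset2P[x y xA yA ->]; rewrite !inE.
  have [->|xy] := eqVneq x y; first by rewrite addVV eqxx.
  apply/orP; right; apply/imsetP; exists [set x; y].
    by rewrite inE cards2 xy subUset !sub1set xA yA.
  by rewrite /total big_setU1 ?inE //= big_set1.
apply: leq_trans (subset_leq_card sub) _.
rewrite cardsU1 addnC leq_add ?leq_b1 // -cards_draws.
exact: leq_imset_card.
Qed.

Lemma unit_vec_ge d j : d <= j -> unit_vec d j = 0%R.
Proof.
move=> dj; apply: bit_inj => i; rewrite bit_unit bit0.
by case: eqP => // <-; rewrite ltnNge dj.
Qed.

Lemma unit_vec_inj d i j : i <= d -> j <= d -> unit_vec d i = unit_vec d j -> i = j.
Proof.
have lt_inj k l : k < d -> unit_vec d k = unit_vec d l -> k = l.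
  move=> kd e; have := bit_unit d k k; rewrite e bit_unit eqxx kd andbT.
  by move/eqP->.
rewrite leq_eqVlt => /orP[/eqP ->|id] jd e; last exact: lt_inj e.
move: jd; rewrite leq_eqVlt => /orP[/eqP -> //|jd].
by apply/esym/(lt_inj _ _ jd).
Qed.

(** The index [d] is out of range, so [unit_vec d d] is the origin: this is the
    affinely independent set of the origin and all unit vectors. *)
Definition simplex d := [set unit_vec d i | i : 'I_d.+1].

Lemma mem_simplex d i : i <= d -> unit_vec d i \in simplex d.
Proof. by move=> id; apply/imsetP; exists (Ordinal (id : i < d.+1)). Qed.

Lemma simplex0 d : 0%R \in simplex d.
Proof. by rewrite -(unit_vec_ge (leqnn d)) mem_simplex. Qed.

Lemma card_simplex d : #|simplex d| = d.+1.
Proof.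
rewrite card_imset ?card_ord // => i j /unit_vec_inj e; apply: val_inj.
by apply: e; rewrite -ltnS.
Qed.

(** A coset through the origin is a subgroup, and the unit vectors generate. *)
Lemma coset_simplex d (C : {set 'rV['F_2]_d}) :
  is_coset C -> simplex d \subset C -> C = [set: 'rV['F_2]_d].
Proof.
case/existsP => H /rcosetsP[x _ ->] /subsetP sC.
have HE : (H :* x)%g = H.
  by apply: rcoset_id; have := sC _ (simplex0 d); rewrite mem_rcoset mul1g groupV.
rewrite {}HE in sC *; apply/setP => z; rewrite inE.
suff sub j : flag d j \subset H by apply/(subsetP (sub d))/flag_all.
elim: j => [|j IH]; apply/subsetP => y yj.
  by rewrite (_ : y = 0%R) ?group1 //; apply: bit_inj => i; rewrite bit0 (flag_ge yj).
have := flag_bitS yj; case: ifP => yb; last exact: (subsetP IH).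
move/(subsetP IH) => yH; rewrite -(addVKC (unit_vec d j) y).
by apply: (groupM _ yH); apply/sC/mem_simplex/ltnW/(bit_lt yb).
Qed.

Lemma affine_span_simplex d (A : {set 'rV['F_2]_d}) : simplex d \subset A ->
  affine_span A = [set: 'rV['F_2]_d].
Proof.
move=> sA; apply: coset_simplex (subset_trans sA (affine_span_sub A)).
apply: affine_span_coset; apply/set0Pn; exists 0%R.
exact: subsetP sA _ (simplex0 d).
Qed.

Lemma card_cylinder d r (A : {set 'rV['F_2]_d}) :
  #|[set x : 'rV['F_2]_(d + r) | lsubmx x \in A]| = #|A| * 2 ^ r.
Proof.
have <- : #|[set: 'rV['F_2]_r]| = 2 ^ r.
  rewrite -(card_flag (leqnn r)); apply: eq_card => x; by rewrite inE flag_all.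
pose glue (u : 'rV['F_2]_d * 'rV['F_2]_r) := row_mx u.1 u.2.
rewrite -cardsX -(card_imset _ (_ : injective glue)).
  apply: eq_card => x; rewrite inE; apply/idP/imsetP => [xA|[[u v] + ->]].
    by exists (lsubmx x, rsubmx x); rewrite /glue ?hsubmxK // !inE xA.
  by rewrite /glue !inE andbT row_mxKl.
by move=> [u v] [u' v'] /eq_row_mx /= [-> ->].
Qed.

Lemma exists_between (T : finType) (A C : {set T}) c : A \subset C ->
  #|A| <= c <= #|C| -> exists B : {set T}, [/\ A \subset B, B \subset C & #|B| = c].
Proof.
move=> AC /andP[Ac cC]; have : 0 < 'C(#|C :\: A|, c - #|A|).
  by rewrite bin_gt0 cardsD (setIidPr AC) leq_sub2r.
rewrite -cards_draws => /card_gt0P[D]; rewrite inE => /andP[DCA /eqP cD].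
exists (A :|: D); split; first exact: subsetUl.
  by rewrite subUset AC (subset_trans DCA) // subsetDl.
rewrite cardsU cD (_ : A :&: D = set0) ?cards0 ?subn0 ?subnKC //.
apply/eqP; rewrite -subset0; apply/subsetP => x /setIP[xA /(subsetP DCA)].
by rewrite inE xA.
Qed.

(** Subsets of the cylinder over [A0] have every cardinality in a wide range,
    while their sumsets stay inside the cylinder over [sumset A0]. *)
Lemma cylinder_subset d r c (A0 : {set 'rV['F_2]_d}) : simplex d \subset A0 ->
  d + r < c <= #|A0| * 2 ^ r -> exists A : {set 'rV['F_2]_(d + r)},
  [/\ #|A| = c, #|sumset A| <= #|sumset A0| * 2 ^ r & #|affine_span A| = 2 ^ (d + r)].
Proof.
move=> sA0 /andP[dc cA0]; set A1 := [set x : 'rV['F_2]_(d + r) | lsubmx x \in A0].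
have [|| A [sA AA1 cA]] := @exists_between _ (simplex (d + r)) A1 c.
- apply/subsetP => _ /imsetP[i _ ->]; rewrite inE.
  rewrite (_ : lsubmx _ = unit_vec d i); last by apply/rowP => j; rewrite !mxE.
  have [id|di] := leqP i d; first exact/(subsetP sA0)/mem_simplex.
  by rewrite unit_vec_ge ?(ltnW di) //; apply/(subsetP sA0)/simplex0.
- by rewrite card_simplex card_cylinder dc.
exists A; split=> //.
  rewrite -card_cylinder; apply/subset_leq_card/subsetP => z /imset2P[x y xA yA ->].
  rewrite inE linearD /= mem_sumset //.
    by have := subsetP AA1 _ xA; rewrite inE.
  by have := subsetP AA1 _ yA; rewrite inE.
rewrite (affine_span_simplex sA) -(card_flag (leqnn (d + r))).
by apply: eq_card => x; rewrite inE flag_all.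
Qed.

Lemma card_sumset_simplex t : #|sumset (simplex t)| <= 'C(t, 2) + t + 1.
Proof.
by apply: leq_trans (card_sumset_le _) _; rewrite card_simplex binS bin1.
Qed.

(** When [base] is a simplex and [e], [p], [q] are independent of it, the two
    parallel copies of [base] share their sums, so that the doubling is smaller
    than for the simplex spanning the same space, at the price of a larger set. *)
Definition prism_over n (base : {set 'rV['F_2]_n}) (e p q : 'rV['F_2]_n) :=
  (base :|: [set (e + x)%R | x in base]) :|: [set p; q].

Lemma card_sumset_prism_over n (base : {set 'rV['F_2]_n}) e p q : 0%R \in base ->
  #|sumset (prism_over base e p q)| <= 2 * #|sumset base| + 4 * #|base| + 1.
Proof.
move=> base0; set S := sumset base; pose D := base :|: [set (e + x)%R | x in base].
have cD : #|D| <= 2 * #|base|.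
  by rewrite mul2n -addnn (leq_trans (leq_card_setU _ _)) // leq_add2l leq_imset_card.
pose T := S :|: [set (e + x)%R | x in S].
have cT : #|T| <= 2 * #|S|.
  by rewrite mul2n -addnn (leq_trans (leq_card_setU _ _)) // leq_add2l leq_imset_card.
(* The five parts: sums within the prism (twice #|S|), sums of the prism with p and
   with q (twice #|base| each), and p + q. *)
pose E := T :|: ([set (p + x)%R | x in D] :|: [set (q + x)%R | x in D]) :|: [set (p + q)%R].
have DD x y : x \in D -> y \in D -> (x + y)%R \in T.
  case/setUP=> [xb|/imsetP[x' xb ->]]; case/setUP=> [yb|/imsetP[y' yb ->]]; apply/setUP.
  - by left; apply: mem_sumset.
  - right; apply/imsetP; exists (x + y')%R; rewrite ?mem_sumset //.
    by rewrite addrCA.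
  - right; apply/imsetP; exists (x' + y)%R; rewrite ?mem_sumset //.
    by rewrite addrA.
  - by left; rewrite addrACA addVV add0r mem_sumset.
have T0 : 0%R \in T by rewrite inE -[0%R]addr0 mem_sumset.
have TE x : x \in T -> x \in E by move=> xT; do 2!(apply/setUP; left).
have pE x : x \in D -> (p + x)%R \in E.
  by move=> xD; apply/setUP; left; apply/setUP; right; apply/setUP; left; apply: imset_f.
have qE x : x \in D -> (q + x)%R \in E.
  by move=> xD; apply/setUP; left; do 2!(apply/setUP; right); apply: imset_f.
have pqE : (p + q)%R \in E by apply/setUP; right; rewrite set11.
have sub : sumset (prism_over base e p q) \subset E.
  apply/subsetP => z /imset2P[x y /setUP[xD|/set2P xpq] /setUP[yD|/set2P ypq] ->].
  - exact/TE/DD.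
  - by rewrite addrC; case: ypq => ->; [apply: pE | apply: qE].
  - by case: xpq => ->; [apply: pE | apply: qE].
  - by case: xpq => ->; case: ypq => ->; rewrite ?addVV ?[(q + p)%R]addrC //; apply: TE.
apply: leq_trans (subset_leq_card sub) _.
apply: leq_trans (leq_card_setU _ _) _; rewrite cards1 leq_add2r.
apply: leq_trans (leq_card_setU _ _) _; apply: leq_add cT _.
apply: leq_trans (leq_card_setU _ _) _.
rewrite -[4]/(2 + 2) mulnDl.
by apply: leq_add; apply: leq_trans (leq_imset_card _ _) cD.
Qed.

(** Coordinate [0] is the axis of the prism and the last two, [t - 1] and [t], are
    the additional points. *)
Definition prism_base t := 0%R |: [set unit_vec t.+1 i.+1 | i : 'I_(t - 2)].

Definition prism t := prism_over (prism_base t)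
  (unit_vec t.+1 0) (unit_vec t.+1 t.-1) (unit_vec t.+1 t).

Lemma simplex_prism t : 2 < t -> simplex t.+1 \subset prism t.
Proof.
move=> t2; apply/subsetP => _ /imsetP[[i /= it] _ ->]; rewrite !inE.
have [->|it1] := eqVneq i t.+1; first by rewrite unit_vec_ge // eqxx.
have [->|it2] := eqVneq i t; first by rewrite eqxx !orbT.
have [->|it3] := eqVneq i t.-1; first by rewrite eqxx !orbT.
case: i => [|i] in it it1 it2 it3 *.
  apply/orP; left; apply/orP; right; apply/imsetP; exists 0%R; rewrite ?addr0 //.
  by rewrite !inE eqxx.
do 2!(apply/orP; left); apply/orP; right; apply/imsetP.
have it4 : i < t - 2 by lia.
by exists (Ordinal it4).
Qed.

(** The prism contains the [t + 2] points of the simplex and [t - 2] further points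
    with exactly two nonzero coordinates. *)
Lemma card_prism_ge t : 2 < t -> 2 * t <= #|prism t|.
Proof.
move=> t2; pose f (i : 'I_(t - 2)) := (unit_vec t.+1 0 + unit_vec t.+1 i.+1)%R.
have f_inj : injective f.
  move=> i j /addrI/unit_vec_inj e; apply/val_inj/succn_inj/e.
    by have := ltn_ord i; lia.
  by have := ltn_ord j; lia.
have dis : [disjoint simplex t.+1 & [set f i | i : 'I_(t - 2)]].
  rewrite -setI_eq0 -subset0; apply/subsetP => z /setIP[/imsetP[j _ ->] /imsetP[i _ e]].
  have it := ltn_ord i; have lt0 : i.+1 < t.+1 by lia.
  have := bit_unit t.+1 j 0; have := bit_unit t.+1 j i.+1.
  by rewrite e !bitD !bit_unit lt0 eqxx /= !andbT => /esym/eqP ->.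
have -> : 2 * t = #|simplex t.+1 :|: [set f i | i : 'I_(t - 2)]|.
  have := leq_card_setU (simplex t.+1) [set f i | i : 'I_(t - 2)].
  move=> /leqifP; rewrite dis => /eqP ->.
  by rewrite card_simplex (card_imset _ f_inj) card_ord; lia.
apply: subset_leq_card; rewrite subUset simplex_prism //=.
apply/subsetP => _ /imsetP[i _ ->]; apply/setUP; left; apply/setUP; right.
by apply/imsetP; exists (unit_vec t.+1 i.+1); rewrite // inE imset_f ?orbT.
Qed.

Lemma card_sumset_prism t : 2 < t -> #|sumset (prism t)| <= t ^ 2 + t + 1.
Proof.
move=> t2; have cb : #|prism_base t| <= t.-1.
  rewrite cardsU1.
  apply: leq_trans (leq_add (leq_b1 _) (leq_imset_card _ _)) _.
  by rewrite card_ord; lia.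
apply: leq_trans (card_sumset_prism_over _ _ _ _) _; first by rewrite !inE eqxx.
have cS : #|sumset (prism_base t)| <= 'C(t.-1, 2) + 1.
  by apply: leq_trans (card_sumset_le _) _; rewrite leq_add2r leq_bin2l.
move: (double_bin2 t.-1) cS cb.
move: #|sumset _| #|prism_base t| 'C(t.-1, 2) => a b c e cS cb.
have [u uE] : exists u, t = u.+3 by exists (t - 3); lia.
by rewrite uE /= in e cS cb *; lia.
Qed.

End Constructions.

(** * The extremal function *)

Section ExtremalFunction.
Variable R : realType.
Implicit Types (K : R) (t : nat).

Lemma double_ball2 t : (t ^ 2 + t + 2 = 2 * ('C(t, 2) + t + 1))%N.
Proof. by have := double_bin2 t; case: t => [|t] /= e; lia. Qed.

Lemma thresholdE t : threshold R t = (t ^ 2 + t + 2)%N%:R / (2 * (t + 1))%N%:R.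
Proof.
rewrite double_ball2 /threshold !natrM -mulf_div divff ?mul1r // pnatr_eq0 //.
Qed.

Lemma threshold_lt i j : (0 < i)%N -> (i < j)%N -> threshold R i < threshold R j.
Proof.
move=> i0 ij; rewrite !thresholdE ltr_pdivrMr ?ltr0n ?muln_gt0 ?addn1 //.
rewrite mulrAC ltr_pdivlMr ?ltr0n ?muln_gt0 ?addn1 // -!natrM ltr_nat.
have [d ->] : exists d, (j = i + d.+1)%N by exists (j - i.+1)%N; lia.
have [e ->] : exists e, (i = e.+1)%N by exists i.-1; lia.
by clear; lia.
Qed.

Lemma threshold1 : threshold R 1 = 1.
Proof. by rewrite thresholdE divff // pnatr_eq0. Qed.

Lemma level_exists K : 1 <= K -> exists t, level_spec K t.
Proof.
move=> K1; have ex : exists n, K < threshold R n.+1.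
  exists (2 * Num.bound K)%N; rewrite thresholdE.
  apply: lt_le_trans (archi_boundP (le_trans ler01 K1)) _.
  rewrite ler_pdivlMr ?ltr0n ?muln_gt0 ?addn1 // -natrM ler_nat.
  by move: (Num.bound K) => n; lia.
case: (ex_minnP ex) => n Kn minn; case: n => [|n] in Kn minn *.
  by rewrite threshold1 ltNge K1 in Kn.
exists n.+1; split=> //; rewrite Kn andbT leNgt; apply/negP => /minn.
by rewrite ltnn.
Qed.

Lemma level_unique K t t' : level_spec K t -> level_spec K t' -> t = t'.
Proof.
have le i j : level_spec K i -> level_spec K j -> (i <= j)%N.
  move=> [i0 /andP[iK _]] [j0 /andP[_ Kj]]; rewrite leqNgt; apply/negP => ji.
  have := le_lt_trans iK Kj; rewrite ltNge => /negP; apply.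
  by move: ji; rewrite leq_eqVlt => /orP[/eqP <- //|ji]; apply/ltW/threshold_lt.
by move=> ht ht'; apply/eqP; rewrite eqn_leq !le.
Qed.

Lemma levelE K t : level_spec K t -> level K = t.
Proof.
move=> ht; apply: (level_unique (K := K)) => //.
by apply: (@xgetPex _ 1%N [set t | level_spec K t]%classic); exists t.
Qed.

Lemma FE K t : level_spec K t -> F K =
  if K < (t ^ 2 + t + 1)%N%:R / (2 * t)%N%:R
  then 2 ^+ t / ('C(t, 2) + t + 1)%N%:R * K
  else 2 ^+ t.+1 / (t ^ 2 + t + 1)%N%:R * K.
Proof. by move=> /levelE e; rewrite /F e. Qed.

Lemma ratio_bound (N s a b c : nat) K : (0 < a)%N -> (0 < b)%N ->
  (N * b <= c * s)%N -> s%:R / a%:R <= K -> N%:R / a%:R <= c%:R / b%:R * K.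
Proof.
move=> a0 b0 le sK; apply: le_trans (ler_wpM2l _ sK).
  rewrite mulf_div ler_pdivrMr ?ltr0n // mulrAC -mulf_div divff ?pnatr_eq0 -?lt0n //.
  by rewrite mulr1 -!natrM ler_pdivlMr ?ltr0n // -natrM ler_nat.
by rewrite divr_ge0.
Qed.

Lemma span_le_F K n (A : {set 'rV['F_2]_n}) : 1 <= K -> A != finset.set0 ->
  #|sumset A|%:R / #|A|%:R <= K -> #|affine_span A|%:R / #|A|%:R <= F K.
Proof.
move=> K1 An0 sK; have [t ht] := level_exists K1; rewrite (FE ht).
have [t0 /andP[_ Kt]] := ht.
have a0 : (0 < #|A|)%N by rewrite card_gt0.
have clear_den (p q : nat) : (0 < q)%N -> K < p%:R / q%:R ->
    (q * #|sumset A| < p * #|A|)%N.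
  move=> q0 /(le_lt_trans sK); rewrite ltr_pdivrMr ?ltr0n // mulrAC.
  by rewrite ltr_pdivlMr ?ltr0n // -!natrM ltr_nat mulnC.
have lt : (2 * (t + 2) * #|sumset A| < (t ^ 2 + 3 * t + 4) * #|A|)%N.
  apply: clear_den; first by rewrite muln_gt0 addn2.
  rewrite thresholdE in Kt; move: Kt.
  rewrite (_ : t.+1 + 1 = t + 2)%N; last by lia.
  by rewrite (_ : t.+1 ^ 2 + t.+1 + 2 = t ^ 2 + 3 * t + 4)%N //; lia.
have [le1 le2] := affine_bound An0 t0 lt.
case: ifP => [Kmid|_]; last first.
  by rewrite -natrX; apply: ratio_bound le1 sK; rewrite // addn1.
rewrite -natrX; apply: ratio_bound _ sK; rewrite ?addn1 //.
have := le2 (clear_den _ _ _ Kmid); rewrite muln_gt0 t0 => /(_ isT).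
by rewrite double_ball2 addn1 expnS mulnCA -!mulnA leq_pmul2l.
Qed.

Lemma exp_dominates (c d M : R) : 0 < c ->
  exists r : nat, d + r%:R < c * 2 ^+ r /\ M < c * 2 ^+ r.
Proof.
move=> c0; pose x := `|d| + `|M| + 1; pose r := (Num.bound (2 * x / c)).+1.
have x0 : 0 < x by rewrite ltr_pwDr // addr_ge0.
have xr : x < r%:R / 2 * c.
  rewrite -ltr_pdivrMr // ltr_pdivlMr // mulrC mulrA.
  apply: lt_trans (archi_boundP _) _; last by rewrite ltr_nat.
  by rewrite divr_ge0 ?mulr_ge0 // ltW.
(* 2 ^ r is at least r ^ 2 / 2, and r was chosen so that r / 2 times c exceeds x. *)
have big : r%:R * x < c * 2 ^+ r.
  apply: lt_le_trans (_ : c * (r%:R ^+ 2 / 2) <= _).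
    rewrite expr2 -mulrA (mulrC c) -mulrA ltr_pM2l // ltr0n //.
  rewrite ler_pM2l // ler_pdivrMr // -natrX -exprSr -natrX ler_nat.
  by apply: leq_trans (ge_double_bin r); rewrite -addnA leq_addr.
have r1 : 1 <= r%:R :> R by rewrite ler1n.
exists r; split; apply: le_lt_trans big.
  apply: le_trans (_ : (r%:R * (`|d| + `|M|) + r%:R <= _)); last first.
    by rewrite /x [X in _ <= X]mulrDr mulr1.
  rewrite lerD2r; apply: le_trans (ler_norm d) _.
  by rewrite -[X in X <= _]mul1r ler_pM // lerDl.
apply: le_trans (ler_norm M) _; rewrite -[X in X <= _]mul1r ler_pM //.
by rewrite /x addrAC lerDr addr_ge0.
Qed.

Definition ratios K : set R :=
  [set r : R | exists (n : nat) (A : {set 'rV['F_2]_n}),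
     [/\ A != finset.set0, #|sumset A|%:R / #|A|%:R <= K
       & r = #|affine_span A|%:R / #|A|%:R]]%classic.

(** In the cylinder of dimension [d + r] the sumset has at most [b * 2 ^ r] elements,
    so the doubling is at most [K] as soon as the set has at least
    [u = b * 2 ^ r / K] points.  The ratio for the least such cardinality, which
    is below [u + 1], tends to [2 ^ d * K / b] as [u] grows. *)
Lemma ratios_dense K d (A0 : {set 'rV['F_2]_d}) (b : nat) y : 0 < K ->
  (simplex d \subset A0)%SET -> (#|sumset A0| <= b)%N -> (0 < b)%N ->
  b%:R <= K * #|A0|%:R -> y < 2 ^+ d / b%:R * K ->
  exists2 r, ratios K r & y < r.
Proof.
move=> K0 sA0 sb b0 bK; set x := _ * K => yx.
have b0' : 0 < b%:R :> R by rewrite ltr0n.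
(* Below, 2 ^ (d + r) = x u, and y (u + 1) < x u once u exceeds y / (x - y). *)
have [r [dr Mr]] := @exp_dominates (b%:R / K) d%:R (`|y| / (x - y)) (divr_gt0 b0' K0).
set u := _ * 2 ^+ r in dr Mr.
have u0 : 0 < u by rewrite mulr_gt0 ?divr_gt0 ?exprn_gt0.
have Ku : K * u = b%:R * 2 ^+ r by rewrite /u mulrA mulrCA divff ?mulr1 // gt_eqF.
have uA : u <= (#|A0| * 2 ^ r)%N%:R.
  rewrite natrM natrX /u ler_pM2r ?exprn_gt0 // ler_pdivrMr //.
  by rewrite mulrC.
have ex : exists c : nat, u <= c%:R by exists (#|A0| * 2 ^ r)%N.
case: (ex_minnP ex) => c uc minc.
have c0 : (0 < c)%N by rewrite -(ltr0n R) (lt_le_trans u0).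
have cu : c%:R < u + 1.
  case: (c) c0 minc => // c' _ minc; rewrite -natr1 ltrD2r ltNge.
  by apply/negP => /minc; rewrite ltnn.
(* The cardinality c is the least one that guarantees a doubling of at most K. *)
have [|A [cA sA spA]] := @cylinder_subset d r c A0 sA0.
  by rewrite minc // andbT -(ltr_nat R) natrD (lt_le_trans dr).
exists ((2 ^ (d + r))%N%:R / c%:R).
  exists (d + r)%N, A; split; last by rewrite spA cA.
    by rewrite -card_gt0 cA.
  rewrite cA ler_pdivrMr ?ltr0n // (le_trans (y := (b * 2 ^ r)%N%:R)) //.
    by rewrite ler_nat (leq_trans sA) // leq_mul2r sb orbT.
  by rewrite natrM natrX -Ku ler_pM2l.
rewrite ltr_pdivlMr ?ltr0n //.
have xu : (2 ^ (d + r))%N%:R = x * u.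
  rewrite natrX exprD /x /u; field; by rewrite !gt_eqF.
rewrite xu; have xy0 : 0 < x - y by rewrite subr_gt0.
rewrite ltr_pdivrMr // in Mr.
have [y0|y0] := lerP y 0.
  apply: le_lt_trans (_ : 0 < _); first by rewrite mulr_le0_ge0.
  rewrite mulr_gt0 // /x mulr_gt0 // divr_gt0 ?exprn_gt0 //.
rewrite gtr0_norm // in Mr.
apply: lt_trans (_ : y * (u + 1) < _); first by rewrite ltr_pM2l.
by nra.
Qed.

Lemma ratios_approach_F K y : 1 <= K -> y < F K -> exists2 r, ratios K r & y < r.
Proof.
move=> K1; have K0 : 0 < K by apply: lt_le_trans K1.
have [t ht] := level_exists K1; rewrite (FE ht); have [t0 /andP[tK Kt]] := ht.
case: ifP => [_|/negbT].
  apply: (ratios_dense K0 (fintype.subxx _) (card_sumset_simplex t)).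
    by rewrite addn1.
  rewrite card_simplex -(addn1 t); by move: tK; rewrite /threshold ler_pdivrMr.
(* On the levels 1 and 2 the middle point is not below the next threshold. *)
rewrite -leNgt => midK; have t2 : (2 < t)%N.
  have := le_lt_trans midK Kt; rewrite thresholdE ltr_pdivrMr ?ltr0n ?muln_gt0 //.
  rewrite mulrAC ltr_pdivlMr ?ltr0n ?muln_gt0 ?addn1 // -!natrM ltr_nat.
  by case: t t0 {ht tK Kt midK} => [|[|[|t]]].
apply: (ratios_dense K0 (simplex_prism t2) (card_sumset_prism t2)).
  by rewrite addn1.
rewrite -ler_pdivrMr; last by rewrite ltr0n (leq_trans _ (card_prism_ge t2)) // muln_gt0.
apply: le_trans midK; rewrite ler_wpM2l // lef_pV2 ?posrE ?ltr0n ?muln_gt0 //.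
  by rewrite ler_nat card_prism_ge.
by rewrite (leq_trans _ (card_prism_ge t2)) // muln_gt0.
Qed.

Lemma F_sup K : 1 <= K -> F K = sup (ratios K).
Proof.
move=> K1; have ub : ubound (ratios K) (F K).
  by move=> _ [n [A [A0 sK ->]]]; apply: span_le_F.
have [|r0 r0K _] := @ratios_approach_F K (F K - 1) K1.
  by rewrite ltrBlDr ltrDl.
apply/eqP; rewrite eq_le; apply/andP; split; last first.
  by apply: ge_sup ub; exists r0.
rewrite leNgt; apply/negP => /(ratios_approach_F K1) [r rK].
by rewrite ltNge => /negP; apply; apply: ub_le_sup rK; exists (F K).
Qed.

(** On the level [t] one has [t / 2 <= K < t / 2 + 1], while both branches of
    [F] are [2 ^ t / t ^ 2] times [K] up to a bounded factor. *)
Lemma F_growth K : 1 <= K ->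
  32^-1 * (2 `^ (2 * K) / K) <= F K <= 2 * (2 `^ (2 * K) / K).
Proof.
move=> K1; have K0 : 0 < K by apply: lt_le_trans K1.
have [t ht] := level_exists K1; have [t0 /andP[tK Kt]] := ht.
have t1 : 1 <= t%:R :> R by rewrite ler1n.
have {}tK : t%:R <= 2 * K.
  move: tK; rewrite thresholdE ler_pdivrMr ?ltr0n ?muln_gt0 ?addn1 //.
  by rewrite !natrD !natrM => h; nra.
have {}Kt : 2 * K <= t%:R + 2.
  move: Kt; rewrite thresholdE ltr_pdivlMr ?ltr0n ?muln_gt0 ?addn1 //.
  by rewrite !natrD !natrM -!natr1 => h; nra.
have Pl : 2 ^+ t <= 2 `^ (2 * K) by rewrite -powR_mulrn // ler_powR // ler1n.
have Pu : 2 `^ (2 * K) <= 4 * 2 ^+ t.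
  have -> : 4 * 2 ^+ t = 2 `^ (t%:R + 2) :> R.
    by rewrite -(natrD _ t 2) powR_mulrn // addn2 !exprS mulrA -natrM.
  by rewrite ler_powR // ler1n.
have w0 : 0 < 2 ^+ t :> R by rewrite exprn_gt0.
have lo0 : 0 < t%:R ^+ 2 + t%:R + 1 :> R by nra.
have hi0 : 0 < t%:R ^+ 2 + t%:R + 2 :> R by nra.
have [Fl Fu] : 2 * 2 ^+ t / (t%:R ^+ 2 + t%:R + 2) * K <= F K /\
    F K <= 2 * 2 ^+ t / (t%:R ^+ 2 + t%:R + 1) * K.
  have le : 2 * 2 ^+ t / (t%:R ^+ 2 + t%:R + 2) * K <=
      2 * 2 ^+ t / (t%:R ^+ 2 + t%:R + 1) * K.
    rewrite ler_pM2r // ler_pM2l ?mulr_gt0 // lef_pV2 ?posrE //.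
    by rewrite lerD2l ler1n.
  have e1 : 2 ^+ t / ('C(t, 2) + t + 1)%N%:R * K =
      2 * 2 ^+ t / (t%:R ^+ 2 + t%:R + 2) * K.
    have -> : t%:R ^+ 2 + t%:R + 2 = 2 * ('C(t, 2) + t + 1)%N%:R :> R.
      rewrite -natrX -!natrD -natrM; congr (_%:R).
      exact: double_ball2.
    by rewrite -mulf_div divff ?mul1r // pnatr_eq0.
  have e2 : 2 ^+ t.+1 / (t ^ 2 + t + 1)%N%:R * K =
      2 * 2 ^+ t / (t%:R ^+ 2 + t%:R + 1) * K.
    by rewrite exprS !natrD natrX.
  by rewrite (FE ht) e1 e2; case: ifP.
move: (2 `^ _) (2 ^+ t) Pl Pu w0 Fl Fu => P w Pl Pu w0 Fl Fu.
apply/andP; split.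
  apply: le_trans Fl; rewrite mulrA ler_pdivrMr // -[_ * K * K]mulrA.
  rewrite [_ / _ * (K * K)]mulrAC ler_pdivlMr // -mulrA ler_pdivrMl //.
  apply: le_trans (_ : 4 * w * (t%:R ^+ 2 + t%:R + 2) <= _).
    by rewrite ler_pM2r.
  have : t%:R ^+ 2 + t%:R + 2 <= 16 * (K * K) by nra.
  by move/(ler_wpM2l (ltW w0)); lra.
apply: le_trans Fu _; rewrite mulrA ler_pdivlMr // -[_ * K * K]mulrA.
rewrite [_ / _ * (K * K)]mulrAC ler_pdivrMr //.
apply: le_trans (_ : 2 * w * (t%:R ^+ 2 + t%:R + 1) <= _).
  rewrite ler_pM2l ?mulr_gt0 //; nra.
by rewrite ler_pM2r // ler_pM2l.
Qed.

End ExtremalFunction.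

Theorem theorem2 (R : realType) :
  [/\ forall K : R, 1 <= K -> exists! t : nat, level_spec K t,
      forall K : R, 1 <= K ->
        forall (n : nat) (A : {set 'rV['F_2]_n}), A != finset.set0 ->
          #|sumset A|%:R / #|A|%:R <= K ->
          #|affine_span A|%:R / #|A|%:R <= F K,
      forall K : R, 1 <= K ->
        F K = sup [set r : R | exists (n : nat) (A : {set 'rV['F_2]_n}),
                     [/\ A != finset.set0,
                         #|sumset A|%:R / #|A|%:R <= K
                       & r = #|affine_span A|%:R / #|A|%:R]]%classic
    & (@F R : R -> R) \is 'Theta_(+oo%R) (fun K : R => 2 `^ (2 * K) / K)].
Proof.
split=> [K K1|K K1 n A A0 sK|K K1|].
- have [t ht] := level_exists K1; exists t; split=> // t'.
  exact: level_unique.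
- exact: span_le_F.
- exact: F_sup.
- apply/asboolP; exists (32^-1, 2); first by rewrite /= invr_gt0 !ltr0n.
  near=> K; have K1 : 1 <= K by near: K; apply: nbhs_pinfty_ge; apply: num_real.
  have /andP[Fl Fu] := F_growth K1.
  have g0 : 0 <= 2 `^ (2 * K) / K :> R.
    by rewrite divr_ge0 ?powR_ge0 // (le_trans ler01).
  have F0 : 0 <= F K by apply: le_trans Fl; rewrite mulr_ge0 // invr_ge0.
  by rewrite !ger0_norm.
Unshelve. all: by end_near.
Qed.
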